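(* Let $o_1,\dots,o_k\in\mathbb{R}^2$ be a finite set of distinct points (obstacles). The obstacle complex of $\{o_1,\dots,o_k\}$ is a cubing, i.e. it is a simply connected cubical complex of nonpositive curvature.
   Context: An increasing curve is a curve $\gamma:\mathbb{R}\to\mathbb{R}^2$ along which both coordinates strictly increase, parameterized by its natural height, i.e. $\gamma(t)=(\gamma_1(t),\gamma_2(t))$ with $\gamma_1(t)+\gamma_2(t)=t$. Via $x=\gamma_1-\gamma_2$, the space of increasing curves is identified with the convex set of functions $x:\mathbb{R}\to\mathbb{R}$ with $|x(t)-x(s)|<|t-s|$ for $t\neq s$, with the topology of uniform convergence on compact sets. For each obstacle $o_i$, the curves through $o_i$ form a codimension-one affine hyperplane $H_i$ in this space, and nonempty intersections of these hyperplanes are transversal. The space of increasing curves is stratified by the obstacles the curves pass through: the strata are the connected components of the sets of curves which pass through a given subset $S$ of obstacles and avoid all others; such a stratum has codimension $|S|$. The obstacle complex is the cell complex dual to this stratification: its vertices correspond to the connected components of the space of curves avoiding all obstacles, its edges to the codimension-one strata (joining the two components adjacent to the stratum), and in general its $d$-dimensional cells to the strata of codimension $d$, where the cell of a stratum $A$ is a face of the cell of a stratum $B$ exactly when $B$ is contained in the closure of $A$. By transversality each such $d$-cell is a $d$-cube, so this is a cubical complex (obtained from cubes by dimension-preserving identifications of faces). A cubical complex is of nonpositive curvature if it satisfies Gromov's condition: in the link of any cube, any collection of pairwise adjacent cubes spans a common cube, i.e. the links are flag simplicial complexes (for three adjacent cubes of the link pairwise sharing a facet, there is a common cube of which they are facets).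 A cubing is a simply connected cubical complex of nonpositive curvature. *)

(* Defs.v *)
From HB Require Import structures.
From Stdlib Require Import Relation_Operators.
From mathcomp Require Import all_boot all_order all_algebra generic_quotient.
From mathcomp Require Import all_classical all_reals all_analysis.

Set Implicit Arguments.
Unset Strict Implicit.
Unset Printing Implicit Defensive.

Import Order.TTheory GRing.Theory Num.Theory.
Import numFieldNormedType.Exports.

Local Open Scope classical_set_scope.
Local Open Scope ring_scope.

(** The set of simplices [D] contains the empty simplex. *)
Definition simplicial_complex (T : Type) (D : set (set T)) : Prop :=
  (forall A, D A -> finite_set A) /\
  (forall A B, D A -> B `<=` A -> D B).

Definition flag (T : Type) (D : set (set T)) : Prop :=
  forall A, finite_set A ->
    (forall v w, A v -> A w -> D [set v; w]) -> D A.

(** A regular cell complex is recorded by its face poset. *)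
Record cell_complex := CellComplex {
  cell :> choiceType;
  cdim : cell -> nat;
  face_of : cell -> cell -> Prop
}.

(** A nonempty face of [0,1]^n: [Some false] (resp. [Some true]) restricts a
    coordinate to 0 (resp. 1), and [None] leaves it free. *)
Definition cube_face (n : nat) := {ffun 'I_n -> option bool}.

Definition cube_face_dim (n : nat) (f : cube_face n) : nat :=
  #|[pred i | f i == None]|.

Definition subface (n : nat) (f g : cube_face n) : Prop :=
  forall i, g i = None \/ f i = g i.

Section CellComplexes.
Variable K : cell_complex.
Implicit Types a b c e v w F G : K.

(** The faces of [c], itself included, form the face poset of a cube. *)
Definition is_cube c : Prop :=
  exists chi : cube_face (cdim c) -> K,
    [/\ forall e, face_of e c <-> exists f, chi f = e,
        forall f g, face_of (chi f) (chi g) <-> subface f g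
      & forall f, cdim (chi f) = cube_face_dim f].

Definition cubical : Prop :=
  [/\ forall a, face_of a a,
      forall a b, face_of a b -> face_of b a -> a = b,
      forall a b c, face_of a b -> face_of b c -> face_of a c
    & forall c, is_cube c].

(** The cubes [e] having [c] as a face are the simplices of the link of [c];
    the vertices of the simplex [e] are the faces [v] of [e] containing [c]
    with [cdim v = (cdim c).+1]. *)
Definition link_vertices c e : set K :=
  [set v | [/\ face_of c v, cdim v = (cdim c).+1 & face_of v e]].

Definition link c : set (set K) :=
  [set link_vertices c e | e in [set e | face_of c e]].

(** Injectivity says that no two simplices of the link have the same
    vertices, so that the link is indeed the simplicial complex [link c]. *)
Definition nonpositive_curvature : Prop :=
  forall c,
    [/\ {in [set e | face_of c e] &, injective (link_vertices c)},
        simplicial_complex (link c)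
      & flag (link c)].

Definition facet F c : Prop := face_of F c /\ cdim c = (cdim F).+1.

Definition disjoint_cells F G : Prop :=
  ~ exists e, face_of e F /\ face_of e G.

Section Realization.
Variable R : realType.

(** The points of the cube [0,1]^n are described without choosing coordinates,
    by their distances [t F] to the 2n facets [F]; the distances to two
    opposite facets add up to 1.  The value of [t] outside the facets is
    irrelevant and set to 0. *)
Definition cube_points c : set {ptws K -> R} :=
  [set t | [/\ forall F, 0 <= t F <= 1,
               forall F, ~ facet F c -> t F = 0
             & forall F G, facet F c -> facet G c -> disjoint_cells F G ->
                 t F + t G = 1]].

Definition cubes := {c : K & cube_points c}.

Definition cube_dist (p : cubes) : K -> R := \val (projT2 p).

(** Let [e] be a face of [c].  The point [p] of the cube [e] is identified
    with the point [q] of the cube [c] when [q] has distance 0 to the facets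
    of [c] containing [e], and the same distance to any other facet [F] of [c]
    as [p] has to the facet of [e] contained in [F], if there is one (otherwise
    [F] is opposite to a facet containing [e]). *)
Definition glued (p q : cubes) : Prop :=
  let e := projT1 p in let c := projT1 q in
  [/\ face_of e c,
      forall F, facet F c -> face_of e F -> cube_dist q F = 0
    & forall F G, facet F c -> ~ face_of e F -> facet G e -> face_of G F ->
        cube_dist q F = cube_dist p G].

Definition glue (p q : cubes) : bool := `[< clos_refl_sym_trans _ glued p q >].

Lemma glue_refl : reflexive glue.
Proof. by move=> p; apply/asboolP; exact: rst_refl. Qed.

Lemma glue_sym : symmetric glue.
Proof. by move=> p q; apply/asboolP/asboolP => pq; exact: rst_sym. Qed.

Lemma glue_trans : transitive glue.
Proof.
move=> q p r /asboolP pq /asboolP qr; apply/asboolP; exact: rst_trans pq qr.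
Qed.

Canonical glue_equiv := EquivRel glue glue_refl glue_sym glue_trans.

Definition realization := quotient_topology {eq_quot glue_equiv}%qT.

End Realization.
End CellComplexes.

Arguments cubical : clear implicits.
Arguments nonpositive_curvature : clear implicits.
Arguments realization : clear implicits.

Definition simply_connected (R : realType) (X : topologicalType) : Prop :=
  [/\ exists x : X, True,
      forall x y : X, exists p : R -> X,
        [/\ {within `[0, 1], continuous p}, p 0 = x & p 1 = y]
    & forall p : R -> X, {within `[0, 1], continuous p} -> p 0 = p 1 ->
        exists H : R * R -> X,
          [/\ {within `[0, 1] `*` `[0, 1], continuous H},
              forall s, s \in `[0, 1] -> H (s, 0) = p s,
              forall s, s \in `[0, 1] -> H (s, 1) = p 0
            & forall t, t \in `[0, 1] -> H (0, t) = p 0 /\ H (1, t) = p 0]].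

Definition cubing (R : realType) (K : cell_complex) : Prop :=
  [/\ cubical K, simply_connected R (realization K R)
    & nonpositive_curvature K].

Section ObstacleComplex.
Variable R : realType.

Definition increasing (g : {family compact, R -> R * R}) : Prop :=
  [/\ {homo (fun t => (g t).1) : s t / s < t},
      {homo (fun t => (g t).2) : s t / s < t}
    & forall t, (g t).1 + (g t).2 = t].

(** The topology is that of uniform convergence on compact sets; it is the same
    for [g] as for the difference [x] of its coordinates. *)
Definition increasing_curve := set_type increasing.

Variables (k : nat) (o : 'I_k -> R * R).

Definition passes_through (g : increasing_curve) (x : R * R) : Prop :=
  exists t, (\val g : R -> R * R) t = x.

Definition exact_locus (S : {set 'I_k}) : set increasing_curve :=
  [set g | forall i, passes_through g (o i) <-> i \in S].

(** A stratum is recorded with the set of obstacles its curves pass through. *)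
Definition is_stratum (p : {set 'I_k} * set increasing_curve) : Prop :=
  exists2 g, exact_locus p.1 g & p.2 = connected_component (exact_locus p.1) g.

Definition stratum := set_type is_stratum.

Definition codim (A : stratum) : nat := #|(\val A).1|.

Definition stratum_set (A : stratum) : set increasing_curve := (\val A).2.

(** The cell complex is dual to the stratification, so faces are larger strata. *)
Definition obstacle_complex : cell_complex :=
  @CellComplex stratum codim
    (fun A B => stratum_set B `<=` closure (stratum_set A)).

End ObstacleComplex.

(* Main.v *)
(** A curve through or to the southeast of an obstacle [o_i] is strictly
    southeast of every obstacle that is weakly northwest of [o_i].  So the sign
    vectors of the curves with respect to the obstacles are those compatible
    with a partial order on the obstacles; each is realized by a nonempty convex
    set of curves, which is a stratum.  The strata are thus the faces of a
    subcomplex of the cube [0,1]^k, defined by conditions on pairs of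
    coordinates, which makes its links flag.  Its realization is the set of [x]
    in [0,1]^k such that [x_j = 1] whenever [j < i] and [x_i > 0].  This is a
    sublattice of [0,1]^k containing a monotone path from 0 to 1, and the lattice
    operations with this path contract every loop relative to its base point. *)
From Stdlib Require Import Relation_Operators.
Require Import Defs.
From mathcomp Require Import all_boot all_order all_algebra generic_quotient.
From mathcomp Require Import all_classical all_reals all_analysis.
From mathcomp Require Import ring lra.

Set Implicit Arguments.
Unset Strict Implicit.
Unset Printing Implicit Defensive.

Import Order.TTheory GRing.Theory Num.Theory.
Import numFieldNormedType.Exports.

Local Open Scope classical_set_scope.
Local Open Scope ring_scope.

(** * Topological preliminaries and clamping to the unit interval *)

Lemma ptws_continuous (I : eqType) (V : topologicalType) (T : topologicalType)
    (f : T -> {ptws I -> V}) :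
  (forall i, continuous (fun t => f t i)) -> continuous f.
Proof.
move=> cf t; apply/cvg_sup => i.
apply/cvg_image; first by apply/seteqP; split=> v // _; exists (cst v).
move=> W /(cf i) Wft; exists ((fun g : I -> V => g i) @^-1` W) => //.
by apply/seteqP; split=> [_ [g Wg <-]|v Wv] //; exists (cst v).
Qed.

(** A loop is continuous only within [[0, 1]]; this transfers it to the square on which homotopies
    live. *)
Lemma within_continuous_fst (S T U : topologicalType) (A : set S) (B : set T)
    (f : S -> U) : {within A, continuous f} ->
  {within A `*` B, continuous (fun x : S * T => f x.1)}.
Proof.
move=> /subspace_continuousP cf; apply/subspace_continuousP => -[s t] [/= As Bt].
move=> W /(cf _ As) Ws; exists ([set u | A u -> W (f u)], setT) => /=.
  by split=> //; exact: filterT.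
by move=> -[u v] [/= + _] [Au _]; apply.
Qed.

Section Clamp.
Variable R : realType.
Implicit Types x y : R.

(** The retraction of the line onto [[0, 1]]. It makes charts, ramps and segments of curves total in
    their real arguments. *)
Definition clamp x : R := Num.max 0 (Num.min 1 x).

Lemma clamp_ge0 x : 0 <= clamp x.
Proof. by rewrite /clamp le_max lexx. Qed.

Lemma clamp_le1 x : clamp x <= 1.
Proof. by rewrite /clamp ge_max ler01 ge_min lexx. Qed.

Lemma clamp_itv x : 0 <= clamp x <= 1.
Proof. by rewrite clamp_ge0 clamp_le1. Qed.

Lemma clamp_gt0 x : 0 < x -> 0 < clamp x.
Proof. by move=> x0; rewrite /clamp lt_max lt_min ltr01 x0 orbT. Qed.

Lemma clamp_id x : 0 <= x <= 1 -> clamp x = x.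
Proof. by move=> /andP[x0 x1]; rewrite /clamp min_r // max_r. Qed.

Lemma clamp_le0 x : x <= 0 -> clamp x = 0.
Proof.
by move=> x0; rewrite /clamp min_r ?max_l // (le_trans x0).
Qed.

Lemma clamp_ge1 x : 1 <= x -> clamp x = 1.
Proof. by move=> x1; rewrite /clamp min_l // max_r. Qed.

Lemma continuous_maxr (T : topologicalType) (f g : T -> R) :
  continuous f -> continuous g -> continuous (fun t => Num.max (f t) (g t)).
Proof.
move=> cf cg t; apply: (@continuous2_cvg _ _ _ _ _ _ f g Num.max (f t) (g t)).
- exact: (@max_continuous _ R (f t, g t)).
- exact: cf.
- exact: cg.
Qed.

Lemma continuous_minr (T : topologicalType) (f g : T -> R) :
  continuous f -> continuous g -> continuous (fun t => Num.min (f t) (g t)).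
Proof.
move=> cf cg t; apply: (@continuous2_cvg _ _ _ _ _ _ f g Num.min (f t) (g t)).
- exact: (@min_continuous _ R (f t, g t)).
- exact: cf.
- exact: cg.
Qed.

Lemma continuous_clamp (T : topologicalType) (f : T -> R) :
  continuous f -> continuous (fun t => clamp (f t)).
Proof.
move=> cf; apply: continuous_maxr; first by move=> ?; exact: cvg_cst.
by apply: continuous_minr => // ?; exact: cvg_cst.
Qed.

End Clamp.

(** The signs [Some false], [None], [Some true] of a curve with respect to an
    obstacle mean northwest of it, through it and southeast of it. *)
Definition admissible (k : nat) (lt : rel 'I_k) (f : cube_face k) : Prop :=
  forall i j, lt j i -> f i != Some false -> f j = Some true.

(** * Faces of the cube as sign vectors *)

Lemma subface_refl n (f : cube_face n) : subface f f.
Proof. by move=> i; right. Qed.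

Lemma subface_trans n (g f h : cube_face n) :
  subface f g -> subface g h -> subface f h.
Proof.
move=> fg gh i; case: (gh i) => [|<-]; first by left.
by case: (fg i); [left|right].
Qed.

Lemma subface_anti n (f g : cube_face n) : subface f g -> subface g f -> f = g.
Proof.
move=> fg gf; apply/ffunP => i.
by case: (fg i) => // gi; case: (gf i) => [fi|//]; rewrite fi gi.
Qed.

Lemma subface_Some n (f g : cube_face n) i b :
  subface f g -> g i = Some b -> f i = Some b.
Proof. by move=> /(_ i)[->|->]. Qed.

(** Passing to a subface keeps every coordinate already fixed, so the admissible vectors form a
    subcomplex of the cube. *)
Lemma admissible_subface k (lt : rel 'I_k) (f g : cube_face k) :
  subface f g -> admissible lt g -> admissible lt f.
Proof.
move=> fg adm i j ij fi; apply: (subface_Some fg); apply: adm ij _.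
by apply: contraNneq fi => /(subface_Some fg) ->.
Qed.

Definition set_coord k (f : cube_face k) i b : cube_face k :=
  [ffun j => if j == i then b else f j].

Lemma set_coord_same k (f : cube_face k) i b : set_coord f i b i = b.
Proof. by rewrite ffunE eqxx. Qed.

Lemma set_coord_neq k (f : cube_face k) i j b : j != i -> set_coord f i b j = f j.
Proof. by rewrite ffunE => /negbTE ->. Qed.

Lemma set_coord_subface k (f : cube_face k) i b :
  f i = None -> subface (set_coord f i b) f.
Proof.
by move=> fi j; rewrite ffunE; case: eqP => [->|_]; [left|right].
Qed.

Lemma subface_free k (f : cube_face k) i : subface f (set_coord f i None).
Proof. by move=> j; rewrite ffunE; case: eqP => _; [left|right]. Qed.

Lemma set_coord_dim k (f : cube_face k) i :
  f i = None -> forall b, cube_face_dim f = (cube_face_dim (set_coord f i (Some b))).+1.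
Proof.
move=> fi b; rewrite /cube_face_dim (cardD1 i) inE fi eqxx add1n.
by congr _.+1; apply: eq_card => j; rewrite !inE ffunE; case: (j == i).
Qed.

(** Some coordinate is free in [g] and fixed in [f]. Fixing it in [g] as in [f] gives a face that
    contains [f] and has the same dimension, hence equals [f]. *)
Lemma codim1_subface k (f g : cube_face k) : subface f g ->
  cube_face_dim g = (cube_face_dim f).+1 ->
  exists i b, [/\ g i = None, f i = Some b & f = set_coord g i (Some b)].
Proof.
move=> fg dimg.
have sub : [pred i | f i == None] \subset [pred i | g i == None].
  apply/fintype.subsetP => i; rewrite !inE => /eqP fi.
  by case: (fg i) => [->//|<-]; rewrite fi.
have : (cube_face_dim f < cube_face_dim g)%N by rewrite dimg.
rewrite ltnNge => /negP ltfg.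
have [i] : exists i, (g i == None) && (f i != None).
  apply/existsP; apply: contra_notT ltfg; rewrite negb_exists => /forallP H.
  apply/subset_leq_card/fintype.subsetP => i; rewrite !inE => gi.
  by have := H i; rewrite gi negbK.
case fi : (f i) => [b|]; last by rewrite andbF.
move=> /andP[/eqP gi _]; exists i, b; split=> //.
have := set_coord_dim gi b; rewrite dimg => -[dimE].
have sfr : subface f (set_coord g i (Some b)).
  move=> j; rewrite ffunE; case: eqP => [->|_]; [by right|exact: fg].
apply: subface_anti => // j.
have : [pred j | f j == None] \subset [pred j | set_coord g i (Some b) j == None].
  apply/fintype.subsetP => l; rewrite !inE => /eqP fl.
  by case: (sfr l) => [->//|<-]; rewrite fl.
move=> /subset_cardP E; have {}E := E dimE j.
have := sfr j; move: E; rewrite !inE.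
by case: (set_coord g i (Some b) j) => [?|]; case: (f j) => [?|] // _ [|->]//; right.
Qed.

(** * Complexes of admissible sign vectors: cubes and links *)

Section SignComplex.
(** The hypotheses make [sg] an isomorphism from the face poset of [K] onto the admissible vectors.
    Its inverse is [cell_of], whose values at other vectors are arbitrary. *)
Variables (k : nat) (lt : rel 'I_k) (K : cell_complex).
Variables (sg : K -> cube_face k) (cell_of : cube_face k -> K).
Hypothesis sg_inj : injective sg.
Hypothesis sg_dim : forall a, cdim a = cube_face_dim (sg a).
Hypothesis sg_face : forall a b : K, face_of a b <-> subface (sg a) (sg b).
Hypothesis sg_adm : forall a, admissible lt (sg a).
Hypothesis cell_ofK : forall f, admissible lt f -> sg (cell_of f) = f.

Lemma cell_of_sub (c : K) f : subface f (sg c) -> sg (cell_of f) = f.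
Proof. by move=> fc; apply: cell_ofK; exact: (@admissible_subface _ _ _ (sg c) fc (@sg_adm c)). Qed.

Lemma sign_is_cube (c : K) : is_cube c.
Proof.
rewrite /is_cube; set n := cdim c.
(* [h] enumerates the free coordinates of [c]. *)
have [h [h_inj h_im]] : exists h : 'I_n -> 'I_k,
    injective h /\ forall i, (sg c i = None) <-> exists j, h j = i.
  have e : n = #|[pred i | sg c i == None]| by rewrite /n sg_dim.
  exists (fun j => enum_val (cast_ord e j)); split.
    by move=> i j /enum_val_inj /cast_ord_inj.
  move=> i; split=> [ci|[j <-]]; last first.
    by have := enum_valP (cast_ord e j); rewrite inE => /eqP.
  have iA : i \in [pred i | sg c i == None] by rewrite inE ci.
  exists (cast_ord (esym e) (enum_rank_in iA i)).
  by rewrite cast_ordKV enum_rankK_in.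
(* A face of the abstract cube fills the free coordinates of [c], and the others keep their signs.
   The result is a subface of [sg c], hence admissible. *)
pose ext (f : cube_face n) : cube_face k :=
  [ffun i => if [pick j | h j == i] is Some j then f j else sg c i].
have extE f j : ext f (h j) = f j.
  rewrite ffunE; case: pickP => [l /eqP/h_inj -> //|/(_ j)].
  by rewrite eqxx.
have extN f i : (forall j, h j <> i) -> ext f i = sg c i.
  by move=> hi; rewrite ffunE; case: pickP => [l /eqP/hi|].
have ext_sub f g : subface (ext f) (ext g) <-> subface f g.
  split=> [fg j|fg i]; first by have := fg (h j); rewrite !extE.
  have [[j <-]|ni] := pselect (exists j, h j = i); first by rewrite !extE.
  by right; rewrite !extN // => j hj; apply: ni; exists j.
have ext_c f : subface (ext f) (sg c).
  move=> i; have [[j hj]|ni] := pselect (exists j, h j = i).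
    by left; apply/h_im; exists j.
  by right; rewrite extN // => j hj; apply: ni; exists j.
have sgE f := cell_of_sub (ext_c f).
exists (fun f => cell_of (ext f)); split.
- move=> e; split=> [/sg_face ec|[f <-]]; last first.
    by apply/sg_face; rewrite sgE.
  exists [ffun j => sg e (h j)]; apply: sg_inj; rewrite sgE; apply/ffunP => i.
  have [[j <-]|ni] := pselect (exists j, h j = i); first by rewrite extE ffunE.
  rewrite extN => [|j hj]; last by apply: ni; exists j.
  by case: (ec i) => [/h_im|->].
- by move=> f g; rewrite sg_face !sgE; exact: ext_sub.
- move=> f; rewrite sg_dim sgE /cube_face_dim.
  rewrite -(fintype.card_image h_inj); apply: eq_card => i; rewrite !inE.
  apply/eqP/fintype.imageP => [fi|[j]]; last by rewrite inE => /eqP fj ->; rewrite extE.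
  have [[j ji]|ni] := pselect (exists j, h j = i).
    by exists j => //; rewrite inE -(extE f) ji fi.
  move: fi; rewrite extN => [/h_im//|j hj]; by apply: ni; exists j.
Qed.

Lemma sign_cubical : cubical K.
Proof.
split.
- by move=> a; apply/sg_face; exact: subface_refl.
- move=> a b /sg_face ab /sg_face ba; exact/sg_inj/subface_anti.
- by move=> a b c /sg_face ab /sg_face bc; apply/sg_face; exact: subface_trans bc.
- exact: sign_is_cube.
Qed.

(** A link vertex of [c] is a direction: by [codim1_subface] it frees exactly one coordinate fixed
    in [c]. *)
Lemma link_verticesP (c e v : K) : face_of c e ->
  link_vertices c e v <-> exists i,
    [/\ sg c i <> None, sg e i = None & sg v = set_coord (sg c) i None].
Proof.
move=> /sg_face ce; split=> [[/sg_face cv]|[i [ci ei vE]]].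
  rewrite !sg_dim => /(codim1_subface cv)[i [b [vi ci cE]]] /sg_face ve.
  exists i; split; first by rewrite ci.
    by case: (ve i) => // vei; rewrite -vei.
  apply/ffunP => j; rewrite ffunE; case: eqP => [->//|/eqP ji].
  by rewrite cE set_coord_neq.
have cv : subface (sg c) (sg v) by rewrite vE; exact: subface_free.
split; first exact/sg_face.
- rewrite !sg_dim vE; case cib : (sg c i) ci => [b|//] _.
  rewrite (set_coord_dim (set_coord_same _ _ _) b); congr (cube_face_dim _).+1.
  by apply/ffunP => j; rewrite !ffunE; case: eqP => [->|].
- apply/sg_face => j; rewrite vE ffunE.
  by case: eqP => [->|_]; [left|exact: ce].
Qed.

Lemma sign_finite (A : set K) : finite_set A.
Proof.
apply: (@sub_finite_set _ _ (cell_of @` setT)); last first.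
  by apply: finite_image; exact: finite_finset.
move=> a _; exists (sg a) => //; apply: sg_inj.
by rewrite cell_ofK.
Qed.

(** The sign vector of the only possible simplex with vertex set [A]. *)
Definition freed (c : K) (A : set K) : cube_face k :=
  [ffun i => if `[< exists2 v, A v & sg v i = None >] then None else sg c i].

(** Reduces the existence of a simplex of the link to the admissibility of one vector. *)
Lemma link_vertices_freed (c : K) (A : set K) :
    (forall v, A v -> exists2 i, sg c i <> None & sg v = set_coord (sg c) i None) ->
    admissible lt (freed c A) ->
  face_of c (cell_of (freed c A)) /\ link_vertices c (cell_of (freed c A)) = A.
Proof.
set f := freed c A => HA adm; have sgf := cell_ofK adm.
have fE i : f i = if `[< exists2 v, A v & sg v i = None >] then None else sg c i.
  by rewrite ffunE.
have cf : face_of c (cell_of f).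
  apply/sg_face; rewrite sgf => i; rewrite fE; case: asboolP => _; by [left|right].
split=> //; apply/seteqP; split=> v.
  move=> /(link_verticesP _ cf)[i []]; rewrite sgf fE => ci.
  case: asboolP => // -[w Aw wi] _ vE.
  have [j cj wE] := HA _ Aw.
  suff -> : v = w by [].
  apply: sg_inj; rewrite vE wE; move: wi; rewrite wE ffunE.
  by case: eqP => [->|].
move=> Av; have [i ci vE] := HA _ Av.
apply/(link_verticesP _ cf); exists i; split=> //.
rewrite sgf fE; case: asboolP => // -[]; exists v => //.
by rewrite vE set_coord_same.
Qed.

(** A simplex is determined by the directions it frees. A subset of them gives a subface, hence an
    admissible vector. Flagness holds because admissibility constrains only two coordinates at a
    time. *)
Lemma sign_nonpositive_curvature : nonpositive_curvature K.
Proof.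
move=> c; split.
- move=> e e'; rewrite !inE => ce ce' E; apply: sg_inj; apply/ffunP => i.
  (* It suffices that equal link vertices give equal free coordinates: elsewhere both cells have the
     signs of [c]. *)
  have free (a b : K) : face_of c a -> face_of c b ->
      link_vertices c a = link_vertices c b -> sg a i = None -> sg b i = None.
    move=> ca cb ab ai; have [ci|ci] := pselect (sg c i = None).
      by case: ((sg_face _ _).1 cb i) => // <-.
    have : link_vertices c a (cell_of (set_coord (sg c) i None)).
      apply/link_verticesP => //; exists i; split=> //; apply: (@cell_of_sub a).
      move=> j; rewrite ffunE; case: eqP => [->|_]; first by left.
      by have /sg_face := ca; apply.
    rewrite ab => /(link_verticesP _ cb)[j [_ bj]].
    rewrite (@cell_of_sub a); last first.
      move=> l; rewrite ffunE; case: eqP => [->|_]; first by left.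
      by have /sg_face := ca; apply.
    move=> /ffunP/(_ i); rewrite !ffunE eqxx.
    by case: eqP => [-> //|_ /esym].
  have [ei|ei] := pselect (sg e i = None); first by rewrite ei (free e e').
  have [ei'|ei'] := pselect (sg e' i = None); first by rewrite ei' (free e' e).
  case: ((sg_face _ _).1 ce i) => // <-.
  by case: ((sg_face _ _).1 ce' i).
- split=> [A _|A B [e /= ce <-] BA]; first exact: sign_finite.
  have HB v : B v -> exists2 i, sg c i <> None & sg v = set_coord (sg c) i None.
    by move=> Bv; have /(link_verticesP _ ce)[i [? _ ?]] := BA _ Bv; exists i.
  have [|cf fB] := link_vertices_freed HB; last by exists (cell_of (freed c B)).
    apply: (@admissible_subface _ _ _ (sg e) _ (@sg_adm e)) => i; rewrite ffunE.
    case: asboolP => [[v Bv vi]|_]; last exact: ((sg_face _ _).1 ce).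
    by have [_ _ /sg_face/(_ i)] := BA _ Bv; rewrite vi; case=> ->; [left|right].
- move=> A _ HA.
  have vert v : A v -> exists2 i, sg c i <> None & sg v = set_coord (sg c) i None.
    move=> Av; have [e /= ce eE] := HA v v Av Av.
    have : link_vertices c e v by rewrite eE; left.
    by move=> /(link_verticesP _ ce)[i [ci _ vE]]; exists i.
  set f := freed c A.
  (* Any two coordinates of [f] are those of an actual cell, which yields each instance of
     admissibility. *)
  have pair i j : exists e : K, sg e i = f i /\ sg e j = f j.
    (* For [e] to agree with [f] at [l], its vertices must lie in [A] and include those of [A] that
       free [l]. *)
    have agree e l : face_of c e -> (forall v, link_vertices c e v -> A v) ->
        (forall v, A v -> sg v l = None -> link_vertices c e v) ->
        sg e l = f l.
      move=> ce eA Ae; rewrite ffunE; case: asboolP => [[v Av vl]|nA].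
        have [_ _ /sg_face/(_ l)] := Ae _ Av vl.
        by rewrite vl; case.
      have [el|] := ((sg_face _ _).1 ce l); last by [].
      have [cl|cl] := pselect (sg c l = None); first by rewrite cl.
      exfalso; apply: nA; exists (cell_of (set_coord (sg c) l None)).
        apply: eA; apply/link_verticesP => //; exists l; split=> //.
        apply: (@cell_of_sub e) => m; rewrite ffunE; case: eqP => [->|_]; first by left.
        exact: ((sg_face _ _).1 ce).
      rewrite (@cell_of_sub e) ?set_coord_same // => m; rewrite ffunE.
      case: eqP => [->|_]; first by left.
      exact: ((sg_face _ _).1 ce).
    have uniq v w l : A v -> A w -> sg c l <> None -> sg v l = None ->
        sg w l = None -> v = w.
      move=> /vert[m cm vE] /vert[m' cm' wE] cl vl wl.
      apply: sg_inj; move: vl wl; rewrite vE wE !ffunE.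
      case: eqP => [<- _|_ /cl//].
      by case: eqP => [<-|_ /cl].
    have cc : face_of c c by apply/sg_face; exact: subface_refl.
    have sub v w e : A v -> A w -> link_vertices c e = [set v; w] ->
        forall u, link_vertices c e u -> A u.
      by move=> Av Aw -> u [] ->.
    (* If [A] is empty, [f] is the sign vector of [c] itself. *)
    have [[v0 Av0]|noA] := pselect (exists v, A v); last first.
      by exists c; rewrite !ffunE !asboolF // => -[v Av _]; apply: noA; exists v.
    (* The vertex of [A] freeing [l] if there is one, and otherwise the dummy [v0]. *)
    have vertex l : exists2 v, A v &
        forall u, A u -> sg c l <> None -> sg u l = None -> u = v.
      have [[v Av vl]|nl] := pselect (exists2 v, A v & sg v l = None).
        by exists v => // u Au cl ul; exact: uniq ul vl.
      by exists v0 => // u Au _ ul; case: nl; exists u.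
    have [[v Av vi] [w Aw wj]] := (vertex i, vertex j).
    have [e /= ce eE] := HA v w Av Aw; exists e.
    have cN l : sg c l = None -> sg e l = f l.
      move=> cl; rewrite ffunE cl if_same.
      by have /sg_face/(_ l)[//|<-] := ce.
    split.
      have [/cN //|ci] := pselect (sg c i = None).
      apply: agree => // [|u Au ui]; first exact: sub eE.
      by rewrite eE; left; exact: vi.
    have [/cN //|cj] := pselect (sg c j = None).
    apply: agree => // [|u Au uj]; first exact: sub eE.
    by rewrite eE; right; exact: wj.
  have [i j ij|cf fA] := link_vertices_freed vert; last by exists (cell_of f).
  by have [e [<- <-]] := pair i j; exact: sg_adm.
Qed.

(** * Facets, and the realization in coordinates of the cube *)

Lemma facetP (F c : K) : facet F c <->
  exists i b, sg c i = None /\ sg F = set_coord (sg c) i (Some b).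
Proof.
split=> [[/sg_face Fc]|[i [b [ci FE]]]].
  by rewrite !sg_dim => /(codim1_subface Fc)[i [b [ci _ FE]]]; exists i, b.
split; first by apply/sg_face; rewrite FE; exact: set_coord_subface.
by rewrite !sg_dim FE (set_coord_dim ci b).
Qed.

Definition facet_of (c : K) i b := cell_of (set_coord (sg c) i (Some b)).

Lemma sg_facet_of (c : K) i b : sg c i = None ->
  sg (facet_of c i b) = set_coord (sg c) i (Some b).
Proof. by move=> ci; apply: (@cell_of_sub c); exact: set_coord_subface. Qed.

Lemma facet_facet_of (c : K) i b : sg c i = None -> facet (facet_of c i b) c.
Proof. by move=> ci; apply/facetP; exists i, b; rewrite sg_facet_of. Qed.

(** Opposite facets disagree on a coordinate of any common face. If the facets are not opposite,
    imposing both constraints gives a common face. *)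
Lemma disjoint_facetsP (c F G : K) i j b b' : sg c i = None -> sg c j = None ->
  sg F = set_coord (sg c) i (Some b) -> sg G = set_coord (sg c) j (Some b') ->
  disjoint_cells F G <-> i = j /\ b' = ~~ b.
Proof.
move=> ci cj FE GE; split=> [disj|[ij b'E]]; last first.
  move=> [e [/sg_face/(_ i) + /sg_face/(_ i)]].
  by rewrite FE GE -ij b'E !set_coord_same => -[//|->] [//|]; case: b {FE b'E}.
apply: contrapT => ij; apply: disj.
exists (cell_of (set_coord (sg G) i (Some b))).
have GF : subface (set_coord (sg G) i (Some b)) (sg F).
  rewrite FE GE => l; rewrite !ffunE; case: eqP => [_|_]; first by right.
  by case: eqP => [->|_]; [left|right].
split; apply/sg_face; rewrite (@cell_of_sub F) //.
rewrite GE => l; rewrite !ffunE; case: eqP => [->|_]; last first.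
  by case: eqP => [->|_]; [left|right].
right; case: eqP => [ji|//]; congr Some; apply: contrapT => bb'; apply: ij.
by split=> //; case: b b' bb' {FE GE GF} => [] [].
Qed.

Section Charts.
Variable R : realType.
Implicit Types (x y : {ptws 'I_k -> R}) (p q : cubes K R).

(** The position of [p] in the cube of dimension [k]: the distance to the facet where a free
    coordinate vanishes is that coordinate. *)
Definition coord p : {ptws 'I_k -> R} := fun i =>
  if sg (projT1 p) i is Some b then b%:R
  else cube_dist p (facet_of (projT1 p) i false).

Lemma cube_dist_points p : @cube_points K R (projT1 p) (cube_dist p).
Proof. by rewrite /cube_dist; case: p => c [t /= /set_mem]. Qed.

Lemma cube_dist_opposite p i : sg (projT1 p) i = None ->
  cube_dist p (facet_of (projT1 p) i true) =
  1 - cube_dist p (facet_of (projT1 p) i false).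
Proof.
move=> pi; have [_ _ opp] := cube_dist_points p.
apply/eqP; rewrite eq_sym subr_eq eq_sym; apply/eqP/opp.
- exact: facet_facet_of.
- exact: facet_facet_of.
- by apply/(disjoint_facetsP pi pi (sg_facet_of _ pi) (sg_facet_of _ pi)).
Qed.

Lemma glued_coord p q : glued p q -> coord p = coord q.
Proof.
move=> [/sg_face ec on_face off_face]; apply/funext => i; rewrite /coord.
case ci : (sg (projT1 q) i) => [b|]; first by rewrite (subface_Some ec ci).
have fc b := facet_facet_of b ci.
case ei : (sg (projT1 p) i) => [b|]; last first.
  apply: esym; apply: off_face => //.
  - by move=> /sg_face/(_ i); rewrite sg_facet_of // set_coord_same ei; case.
  - exact: facet_facet_of.
  - apply/sg_face; rewrite !sg_facet_of // => j; rewrite !ffunE.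
    by case: eqP => [_|_]; [right|exact: ec].
(* The cube of [p] lies in this facet of the cube of [q], so gluing puts [q] on it. *)
have q0 : cube_dist q (facet_of (projT1 q) i b) = 0.
  apply: on_face => //; apply/sg_face; rewrite sg_facet_of // => j.
  by rewrite ffunE; case: eqP => [->|_]; [right|exact: ec].
case: b q0 {ei} => //; rewrite cube_dist_opposite // => /eqP.
by rewrite subr_eq0 => /eqP <-.
Qed.

Lemma glue_coord p q : Defs.glue p q -> coord p = coord q.
Proof.
move=> /asboolP; elim=> [u v uv|//|u v _ ->|u v w _ -> _ ->] //.
exact: glued_coord.
Qed.

(** Inverse to [coord] on the cube [c]. The picked [i] is the one coordinate that the facet [F]
    fixes and [c] leaves free; the value 0 off the facets is the convention of [cube_points]. *)
Definition chart_dist (c : K) x (F : K) : R :=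
  if `[< facet F c >] then
    if [pick i | (sg c i == None) && (sg F i != None)] is Some i then
      if sg F i == Some true then 1 - clamp (x i) else clamp (x i)
    else 0
  else 0.

Lemma chart_distE (c F : K) x i b : sg c i = None ->
  sg F = set_coord (sg c) i (Some b) ->
  chart_dist c x F = if b then 1 - clamp (x i) else clamp (x i).
Proof.
move=> ci FE; rewrite /chart_dist asboolT; last by apply/facetP; exists i, b.
case: pickP => [j|/(_ i)]; last by rewrite FE set_coord_same ci.
move=> /andP[/eqP cj]; rewrite FE ffunE.
by case: (j =P i) => [->|_]; [case: b {FE}|rewrite cj].
Qed.

Lemma chart_dist_points (c : K) x : @cube_points K R c (chart_dist c x).
Proof.
split.
- move=> F; have [/facetP[i [b [ci FE]]]|nF] := pselect (facet F c); last first.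
    by rewrite /chart_dist asboolF // lexx ler01.
  rewrite (chart_distE _ ci FE); have := clamp_ge0 (x i); have := clamp_le1 (x i).
  by case: b {FE}; lra.
- by move=> F nF; rewrite /chart_dist asboolF.
- move=> F G /facetP[i [b [ci FE]]] /facetP[j [b' [cj GE]]].
  move=> /(disjoint_facetsP ci cj FE GE)[ij b'E]; subst j b'.
  rewrite (chart_distE _ ci FE) (chart_distE _ cj GE).
  by case: b {FE GE} => /=; rewrite ?subrK // subrKC.
Qed.

Definition chart_point (c : K) x : cubes K R :=
  existT _ c (SigSub (mem_set (chart_dist_points c x))).

Definition chart (c : K) x : realization K R :=
  (\pi_(realization K R) (chart_point c x))%qT.

Lemma chart_continuous (c : K) : continuous (chart c).
Proof.
move=> x; apply: (@continuous_comp _ _ _ (chart_point c)); last exact: pi_continuous.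
apply: (@continuous_comp _ _ _
  (fun x => SigSub (mem_set (chart_dist_points c x)) : @cube_points K R c)).
  apply: continuous_comp_initial; apply: ptws_continuous => F {x}.
  change (continuous (fun x : {ptws 'I_k -> R} => chart_dist c x F)).
  have [/facetP[i [b [ci FE]]]|nF] := pselect (facet F c); last first.
    have -> : chart_dist c ^~ F = cst 0.
      by apply/funext => x; rewrite /= /chart_dist asboolF.
    exact: cst_continuous.
  have -> : chart_dist c ^~ F =
      fun x => if b then 1 - clamp (x i) else clamp (x i).
    by apply/funext => x; rewrite -(chart_distE _ ci FE).
  have ci_cont : continuous (fun x : {ptws 'I_k -> R} => clamp (x i)).
    by apply: continuous_clamp => x; exact: (@proj_continuous _ (fun=> R) i).
  case: b {FE}; last exact: ci_cont.
  move=> x; apply: (@continuous_comp _ _ _ (fun x => clamp (x i)) (fun r => 1 - r)).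
    exact: ci_cont.
  by apply: cvgB; [exact: cvg_cst|exact: cvg_id].
exact: existT_continuous.
Qed.

Definition in_cell (c : K) x : Prop :=
  (forall i, 0 <= x i <= 1) /\ forall i b, sg c i = Some b -> x i = b%:R.

(** The cube complex seen as a subset of [0,1]^k. *)
Definition body : set {ptws 'I_k -> R} :=
  [set x | (forall i, 0 <= x i <= 1) /\
           (forall i j, lt j i -> 0 < x i -> x j = 1)].

(** For [x] in [body], the smallest cell containing [x]. *)
Definition carrier x : cube_face k :=
  [ffun i => if x i == 0 then Some false else if x i == 1 then Some true else None].

Definition point_of x : realization K R := chart (cell_of (carrier x)) x.

Lemma carrier_admissible x : body x -> admissible lt (carrier x).
Proof.
move=> [x01 xlt] i j ij; rewrite !ffunE; case: (x i =P 0) => // /eqP xi0 _.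
rewrite (xlt i j) // ?oner_eq0 ?eqxx //.
by rewrite lt_neqAle eq_sym xi0; case/andP: (x01 i).
Qed.

Lemma carrier_subface (c : K) x : in_cell c x -> subface (carrier x) (sg c).
Proof.
move=> [_ xc] i; case ci : (sg c i) => [b|]; [right|by left].
by rewrite ffunE (xc _ _ ci); case: b {ci}; rewrite ?oner_eq0 eqxx.
Qed.

Lemma carrier_in_cell x : body x -> in_cell (cell_of (carrier x)) x.
Proof.
move=> bx; split=> [|i b]; first by case: bx.
rewrite (cell_ofK (@carrier_admissible x bx)) ffunE.
by case: eqP => [-> [<-]//|_]; case: eqP => [-> [<-]|].
Qed.

Lemma in_cell_body (c : K) x : in_cell c x -> body x.
Proof.
move=> [x01 xc]; split=> // i j ij xi; apply: (xc _ true).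
apply: (sg_adm ij); apply/eqP => ci; move: xi.
by rewrite (xc _ _ ci) ltxx.
Qed.

(** The carrier is a face of every cell containing [x], and one gluing step identifies the two
    copies of [x]. *)
Lemma point_of_chart (c : K) x : in_cell c x -> point_of x = chart c x.
Proof.
move=> xc; have sge := cell_of_sub (carrier_subface xc).
apply/eqmodP/asboolP/rst_step; split.
- by apply/sg_face; rewrite sge; exact: carrier_subface.
(* A facet containing the carrier fixes a coordinate at which [x] is already 0 or 1. *)
- move=> F /facetP[i [b [ci FE]]] /sg_face/(_ i).
  rewrite sge /cube_dist /= (chart_distE _ ci FE) FE set_coord_same => -[//|].
  rewrite ffunE; case: eqP => [-> [<-]|_]; first by rewrite clamp_id // lexx ler01.
  by case: eqP => // -> [<-]; rewrite clamp_id ?subrr // lexx ler01.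
- move=> F G /facetP[i [b [ci FE]]] nF /facetP[j [b' [ej GE]]] /sg_face GF.
  (* If [F] and [G] fixed different coordinates, [F] would contain the whole carrier. *)
  have ij : i = j.
    apply: contrapT => ij; apply: nF; apply/sg_face => l; rewrite FE ffunE.
    case: eqP => [->|_]; last by rewrite sge; exact: carrier_subface.
    have := GF i; rewrite FE GE set_coord_same.
    by rewrite set_coord_neq; [right; case: H|exact/eqP].
  subst j; have := GF i; rewrite FE GE !set_coord_same => -[//|[bb']].
  by rewrite /cube_dist /= (chart_distE _ ci FE) (chart_distE _ ej GE) bb'.
Qed.

Lemma coord_in_cell p : in_cell (projT1 p) (coord p).
Proof.
have [t01 _ _] := cube_dist_points p.
split=> [i|i b pi]; rewrite /coord; last by rewrite pi.
by case: (sg _ i) => [[]|] //=; rewrite lexx ler01.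
Qed.

Lemma chart_coord p : chart (projT1 p) (coord p) = (\pi_(realization K R) p)%qT.
Proof.
have [t01 t0 _] := cube_dist_points p.
congr (\pi_(realization K R) _)%qT.
suff : cube_dist (chart_point (projT1 p) (coord p)) = cube_dist p.
  rewrite /chart_point /cube_dist; case: p {t01 t0} => c t /= tE.
  by congr existT; exact: val_inj.
apply/funext => F; rewrite /cube_dist /=.
have [/facetP[i [b [ci FE]]]|nF] := pselect (facet F (projT1 p)); last first.
  by rewrite /chart_dist asboolF // -[RHS]/(cube_dist p F) t0.
rewrite (chart_distE _ ci FE) /coord ci clamp_id // -[RHS]/(cube_dist p F).
have -> : F = facet_of (projT1 p) i b by apply: sg_inj; rewrite sg_facet_of.
by case: b {FE} => //; rewrite cube_dist_opposite.
Qed.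

Definition realization_coord (z : realization K R) : {ptws 'I_k -> R} :=
  coord (repr z).

(** [coord] is continuous on each cube and constant on gluing classes, so it descends to the
    quotient. *)
Lemma realization_coord_continuous : continuous realization_coord.
Proof.
apply: repr_comp_continuous; last first.
  by move=> p q /eqP/eqmodP/glue_coord ->.
suff cont c : continuous (fun t : @cube_points K R c => coord (existT _ c t)).
  by move=> [c t] U nU; exact: (cont c t U nU).
apply: ptws_continuous => i.
rewrite /coord /=; case ci : (sg c i) => [b|]; first exact: cst_continuous.
move=> t; apply: (@continuous_comp _ {ptws K -> R} _ (fun t : @cube_points K R c => \val t)
  (fun t => t (facet_of c i false))).
  exact: initial_continuous.
exact: (@proj_continuous _ (fun=> R)).
Qed.

Lemma body_realization_coord z : body (realization_coord z).
Proof. exact: in_cell_body (coord_in_cell _). Qed.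

(** This one-sided inverse suffices: paths and loops are carried to [body], deformed there and
    brought back. *)
Lemma realization_coordK z : point_of (realization_coord z) = z.
Proof.
rewrite (point_of_chart (coord_in_cell _)) chart_coord; exact: reprK.
Qed.

(** Pasting over a finite closed cover: on the points of a cell, [point_of] is the continuous chart
    of that cell. *)
Lemma point_of_continuous (T : topologicalType) (f : T -> {ptws 'I_k -> R}) :
  continuous f -> (forall t, body (f t)) -> continuous (point_of \o f).
Proof.
move=> cf bf; apply/continuous_closedP => C cC.
have -> : (point_of \o f) @^-1` C =
    \bigcup_c (f @^-1` in_cell c `&` (chart c \o f) @^-1` C).
  apply/seteqP; split=> [t Ct|t [c _ [/= ft]]].
    have ft := carrier_in_cell (bf t); exists (cell_of (carrier (f t))) => //.
  by rewrite -(point_of_chart ft).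
have closed_pre (i : 'I_k) (A : set R) : closed A -> closed [set t | A (f t i)].
  move: A; apply/continuous_closedP => t.
  apply: (@continuous_comp _ _ _ f (fun x : {ptws 'I_k -> R} => x i)).
    exact: cf.
  exact: (@proj_continuous _ (fun=> R)).
apply: closed_bigcup => [|c _]; first exact: sign_finite.
apply: closedI.
  (* Membership in a cell is a conjunction of closed conditions on single coordinates. *)
  rewrite (_ : _ @^-1` _ = \bigcap_i [set t | `[0, 1]%classic (f t i)] `&`
     \bigcap_(ib in [set ib : 'I_k * bool | sg c ib.1 = Some ib.2])
        [set t | [set (ib.2%:R : R)] (f t ib.1)]); last first.
    apply/seteqP; split=> t /=.
      move=> [f01 fc]; split=> [i _|[i b] /fc //].
      by rewrite /= in_itv; exact: f01.
    move=> [f01 fc]; split=> [i|i b ci]; last exact: (fc (i, b)).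
    by have /= := f01 i I; rewrite in_itv.
  apply: closedI; apply: closed_bigI => i _; apply: closed_pre.
    exact: interval_closed.
  exact: closed_eq.
have : continuous (chart c \o f).
  move=> t; apply: continuous_comp; [exact: cf|exact: chart_continuous].
by move/continuous_closedP; apply.
Qed.

(** * Simple connectedness by lattice operations *)

Hypothesis lt_irr : irreflexive lt.
Hypothesis lt_trans : transitive lt.

(** A strictly monotone numbering with values below [k]. *)
Definition rank i : nat := #|[pred j | lt j i]|.

Lemma rank_lt i j : lt j i -> (rank j < rank i)%N.
Proof.
move=> ji; apply/proper_card/fintype.properP; split.
  by apply/fintype.subsetP => l; rewrite !inE => /lt_trans; apply.
by exists j; rewrite !inE // lt_irr.
Qed.

Lemma rank_lt_dim i : (rank i < k)%N.
Proof.
rewrite -[leqRHS]card_ord; apply/proper_card/fintype.properP.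
by split; [exact/fintype.subsetP|exists i; rewrite // inE lt_irr].
Qed.

(** A path in the body from the origin to [1, ..., 1], raising the
    coordinates in the order of their ranks. *)
Definition ramp (s : R) : {ptws 'I_k -> R} := fun i => clamp (s - (rank i)%:R).

(** Coordinate [i] becomes positive only after time [rank i], which is at least [rank j + 1], when
    coordinate [j] is full. *)
Lemma body_ramp s : body (ramp s).
Proof.
split=> [i|i j ji]; first by rewrite clamp_ge0 clamp_le1.
rewrite /ramp => si; apply: clamp_ge1.
have {}si : (rank i)%:R < s.
  by rewrite ltNge; apply: contraTN si => si; rewrite clamp_le0 ?ltxx // subr_le0.
by rewrite lerBrDr addrC natr1 (le_trans _ (ltW si)) // ler_nat rank_lt.
Qed.

Lemma ramp0 s i : s <= 0 -> ramp s i = 0.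
Proof. by move=> s0; apply: clamp_le0; rewrite subr_le0 (le_trans s0). Qed.

Lemma ramp1 s i : k%:R <= s -> ramp s i = 1.
Proof.
move=> ks; apply: clamp_ge1; rewrite lerBrDr addrC natr1 (le_trans _ ks) //.
by rewrite ler_nat rank_lt_dim.
Qed.

Lemma body_min x y : body x -> body y ->
  body (fun i => Num.min (x i) (y i)).
Proof.
move=> [x01 xlt] [y01 ylt]; split=> [i|i j ji].
  have /andP[x0 x1] := x01 i; have /andP[y0 y1] := y01 i.
  by rewrite le_min x0 y0 ge_min x1.
rewrite lt_min => /andP[xi yi].
by rewrite (xlt _ _ ji xi) (ylt _ _ ji yi) minxx.
Qed.

(** If one of the two points is positive at [i], it equals 1 at [j], which is the largest possible
    value. *)
Lemma body_max x y : body x -> body y ->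
  body (fun i => Num.max (x i) (y i)).
Proof.
move=> [x01 xlt] [y01 ylt]; split=> [i|i j ji].
  have /andP[x0 x1] := x01 i; have /andP[y0 y1] := y01 i.
  by rewrite le_max x0 ge_max x1 y1.
have /andP[x0 x1] := x01 j; have /andP[y0 y1] := y01 j.
rewrite lt_max => /orP[xi|yi].
  by rewrite (xlt _ _ ji xi) max_l.
by rewrite (ylt _ _ ji yi) max_r.
Qed.

(** The first ramp is constantly 1 for [s <= 1/2] and the second for [s >= 1/2],
    so that sliding from a point to itself is constant. *)
Definition slide x y (s : R) : {ptws 'I_k -> R} := fun i =>
  Num.max (Num.min (x i) (ramp (2 * k%:R * (1 - s)) i))
          (Num.min (y i) (ramp (2 * k%:R * s) i)).

Lemma body_slide x y s : body x -> body y -> body (slide x y s).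
Proof. by move=> bx b_y; apply: body_max; apply: body_min => //; exact: body_ramp. Qed.

Lemma ramp_half s i : 0 <= s <= 1 ->
  ramp (2 * k%:R * (1 - s)) i = 1 \/ ramp (2 * k%:R * s) i = 1.
Proof.
move=> /andP[s0 s1]; have k0 : 0 <= k%:R :> R := ler0n _ _.
(* One of [s] and [1 - s] is at least 1/2, so its ramp has reached time [k], when all coordinates
   are full. *)
by have [sh|sh] := leP s 2^-1; [left|right]; apply: ramp1; nra.
Qed.

Lemma slide0 x y : body x -> body y -> slide x y 0 = x.
Proof.
move=> [x01 _] [y01 _]; apply/funext => i; rewrite /slide.
have /andP[x0 x1] := x01 i; have /andP[y0 y1] := y01 i.
rewrite mulr0 (@ramp0 0) // (min_r y0) max_l; last first.
  by rewrite le_min x0; case/andP: ((body_ramp (2 * k%:R * (1 - 0))).1 i).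
rewrite ramp1 ?min_l // subr0 mulr1 -[leLHS]mul1r ler_wpM2r //; lra.
Qed.

Lemma slide1 x y : body x -> body y -> slide x y 1 = y.
Proof.
move=> bx b_y; rewrite -[RHS](slide0 b_y bx); apply/funext => i.
by rewrite /slide subrr subr0 maxC.
Qed.

Lemma slide_const x s : body x -> 0 <= s <= 1 -> slide x x s = x.
Proof.
move=> [x01 _] s01; apply/funext => i; rewrite /slide.
have /andP[x0 x1] := x01 i.
have [->|->] := ramp_half i s01; rewrite (min_l x1).
  by rewrite max_l // ge_min lexx.
by rewrite max_r // ge_min lexx.
Qed.

Lemma slide_continuous (T : topologicalType) (f : T -> {ptws 'I_k -> R}) y
    (g : T -> R) : continuous f -> continuous g ->
  continuous (fun t => slide (f t) y (g t)).
Proof.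
move=> cf cg; apply: ptws_continuous => i.
have cr (c : R) (h : T -> R) : continuous h -> continuous (fun t => ramp (c * h t) i).
  move=> ch; apply: continuous_clamp => t.
  apply: cvgB; last exact: cvg_cst.
  by apply: cvgM; [exact: cvg_cst|exact: ch].
apply: continuous_maxr; apply: continuous_minr.
- move=> t; apply: (@continuous_comp _ _ _ f (fun x : {ptws 'I_k -> R} => x i)).
    exact: cf.
  exact: (@proj_continuous _ (fun=> R)).
- by apply: cr => t; apply: cvgB; [exact: cvg_cst|exact: cg].
- exact: cst_continuous.
- exact: cr.
Qed.

Lemma sign_simply_connected : simply_connected R (realization K R).
Proof.
pose co := realization_coord; have bco := body_realization_coord.
split.
- by exists (point_of (ramp 0)).
- move=> z w; exists (fun s => point_of (slide (co z) (co w) s)); split.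
  + apply: continuous_subspaceT; apply: point_of_continuous => [|s]; last exact: body_slide.
    by apply: slide_continuous; [exact: cst_continuous|move=> ?; exact: cvg_id].
  + by rewrite slide0 // realization_coordK.
  + by rewrite slide1 // realization_coordK.
(* Each point of the loop slides to the base point. Both ends slide from the base point to itself,
   so they stay fixed by [slide_const]. *)
move=> p cp p01; exists (fun st => point_of (slide (co (p st.1)) (co (p 0)) st.2)).
split.
- set A := _ `*` _.
  apply: (@point_of_continuous (subspace A)
    (fun st => slide (co (p st.1)) (co (p 0)) st.2)) => [|st]; last exact: body_slide.
  apply: (@slide_continuous (subspace A) (fun st => co (p st.1)) _ snd).
    move=> st; apply: (@continuous_comp (subspace A) _ _ (fun st => p st.1) co).
      exact: (@within_continuous_fst _ _ _ _ _ p cp).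
    exact: realization_coord_continuous.
  by apply: continuous_subspaceT => st; exact: cvg_snd.
- by move=> s _ /=; rewrite slide0 // realization_coordK.
- by move=> s _ /=; rewrite slide1 // realization_coordK.
- move=> t; rewrite in_itv /= => t01.
  by rewrite -p01 slide_const // realization_coordK.
Qed.

Lemma sign_cubing : cubing R K.
Proof.
split; [exact: sign_cubical|exact: sign_simply_connected|].
exact: sign_nonpositive_curvature.
Qed.

End Charts.
End SignComplex.

(** The first coordinates of the increasing curves [(u t, t - u t)]. *)
Definition slope (R : realType) (u : R -> R) : Prop :=
  forall s t, s < t -> u s < u t < u s + (t - s).

(** * Increasing curves and the segments joining them *)

Section Slope.
Variable R : realType.
Implicit Types u v : R -> R.

Lemma slope_max u v : slope u -> slope v -> slope (fun t => Num.max (u t) (v t)).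
Proof.
move=> su sv s t st; have /andP[u1 u2] := su _ _ st; have /andP[v1 v2] := sv _ _ st.
by case: (leP (u s) (v s)) => h1; case: (leP (u t) (v t)) => h2; lra.
Qed.

Lemma slope_min u v : slope u -> slope v -> slope (fun t => Num.min (u t) (v t)).
Proof.
move=> su sv s t st; have /andP[u1 u2] := su _ _ st; have /andP[v1 v2] := sv _ _ st.
by case: (leP (u s) (v s)) => h1; case: (leP (u t) (v t)) => h2; lra.
Qed.

Lemma slope_affine (c a h : R) : 0 < c < 1 -> slope (fun t => a + c * (t - h)).
Proof. by move=> c01 s t st; nra. Qed.

Lemma slope_bigmax (I : Type) (r : seq I) (P : pred I) (F : I -> R -> R) u :
  slope u -> (forall i, slope (F i)) ->
  slope (fun t => \big[Num.max/u t]_(i <- r | P i) F i t).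
Proof.
move=> su sF; elim: r => [|i r IHr] s t st; first by rewrite !big_nil; exact: su.
rewrite !big_cons; case: (P i); last exact: IHr.
exact: (slope_max (sF i) IHr).
Qed.

Lemma slope_convex u v (c : R) : 0 <= c <= 1 -> slope u -> slope v ->
  slope (fun t => (1 - c) * u t + c * v t).
Proof.
move=> /andP[c0 c1] su sv s t st.
have /andP[u1 u2] := su _ _ st; have /andP[v1 v2] := sv _ _ st.
by case: (leP (u t - u s) (v t - v s)) => h; nra.
Qed.

Lemma slope_lipschitz u s t : slope u -> `|u s - u t| <= `|s - t|.
Proof.
move=> su; have [st|ts|->] := ltgtP s t; last by rewrite !subrr.
- have /andP[? ?] := su _ _ st.
  by rewrite distrC (distrC s) !ger0_norm; lra.
- by have /andP[? ?] := su _ _ ts; rewrite !ger0_norm; lra.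
Qed.

Lemma increasing_of_slope u : slope u ->
  increasing (fun t => (u t, t - u t) : R * R).
Proof.
move=> su; split=> [s t /su /andP[]//|s t st|t] /=; last by rewrite addrC subrK.
by have /andP[? ?] := su _ _ st; lra.
Qed.

Definition curve u (su : slope u) : increasing_curve R :=
  SigSub (mem_set (increasing_of_slope su)).

Definition abscissa (g : increasing_curve R) (t : R) : R :=
  ((\val g : R -> R * R) t).1.

Lemma abscissa_slope g : slope (abscissa g).
Proof.
have /set_mem[g1 g2 gt] := valP g; move=> s t st.
have := g1 _ _ st; have := g2 _ _ st; have := gt s; have := gt t.
rewrite /abscissa; lra.
Qed.

Lemma val_abscissa g t : (\val g : R -> R * R) t = (abscissa g t, t - abscissa g t).
Proof.
have /set_mem[_ _ gt] := valP g.
rewrite [LHS]surjective_pairing; congr pair; have := gt t; rewrite /abscissa; lra.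
Qed.

Lemma abscissa_inj g h : abscissa g =1 abscissa h -> g = h.
Proof.
by move=> gh; apply: val_inj; apply/funext => t; rewrite !val_abscissa gh.
Qed.

(** Singletons are compact, so evaluation at a point is continuous. *)
Lemma abscissa_continuous t : continuous (fun g : increasing_curve R => abscissa g t).
Proof.
move=> g; apply: (@continuous_comp _ {family compact, R -> R * R} _
  (fun g : increasing_curve R => \val g) (fun f => (f t).1)).
  exact: initial_continuous.
move: (\val g) => f; apply: (@cvg_comp _ _ _ (fun f : {family compact, R -> R * R} => f t) fst
  _ (nbhs (f t))); last exact: cvg_fst.
move=> U; rewrite -nbhs_entourageE => -[E entE EU].
have := fam_nbhs f entE (@compact_set1 _ t).
by apply: filterS => h /(_ t erefl) Eh; apply/EU/xsectionP.
Qed.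

Definition segment_curve (g h : increasing_curve R) (s : R) : increasing_curve R :=
  curve (slope_convex (clamp_itv s) (abscissa_slope g) (abscissa_slope h)).

Lemma segment_curve_continuous g h : continuous (segment_curve g h).
Proof.
apply: continuous_comp_initial => s; apply/fam_cvgP => A cA P.
move=> /uniform_nbhs[E [+ EP]]; rewrite -entourage_ballE => -[e /= e0 eE].
have [M [_ /(_ (M + 1))]] := compact_bounded cA.
rewrite ltrDl ltr01 => /(_ isT) AM.
(* Both abscissas are 1-Lipschitz and [A] lies within [M + 1] of 0, so [D] bounds their difference
   on [A]. The last 1 makes [D] positive. *)
pose D := `|abscissa g 0| + `|abscissa h 0| + 2 * `|M + 1| + 1.
have D0 : 0 < D by rewrite ltr_wpDl // !addr_ge0 // mulr_ge0.
have AD t : A t -> `|abscissa g t - abscissa h t| <= D.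
  move=> /AM /= tM; have := slope_lipschitz t 0 (abscissa_slope g).
  have := slope_lipschitz t 0 (abscissa_slope h); rewrite !subr0 /D.
  have := ler_norm (M + 1); move: tM; set B := M + 1.
  by rewrite !ler_norml; do ![case: ger0P => ?]; lra.
have : continuous (@clamp R) by apply: continuous_clamp => ?; exact: cvg_id.
move=> /(_ s)/cvgr_dist_lt/(_ (e / D)); rewrite divr_gt0 // => /(_ isT).
apply: filterS => s' ss'; apply: EP => t At; apply: eE => /=.
have dist : `|(clamp s - clamp s') * (abscissa g t - abscissa h t)| < e.
  rewrite normrM (le_lt_trans (ler_wpM2l _ (AD t At))) //.
  by rewrite -ltr_pdivlMr.
(* Since the coordinates add up to [t], both change by the same amount, with opposite signs. *)
split; rewrite /= /ball /=.
  by move: dist; rewrite -normrN; congr (`|_| < _); ring.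
by move: dist; congr (`|_| < _); ring.
Qed.

Lemma segment_curve0 g h : segment_curve g h 0 = g.
Proof.
apply: abscissa_inj => t; rewrite /abscissa /= clamp_le0 //.
by rewrite subr0 mul1r mul0r addr0.
Qed.

Lemma segment_curve1 g h : segment_curve g h 1 = h.
Proof.
apply: abscissa_inj => t; rewrite /abscissa /= clamp_ge1 //.
by rewrite subrr mul0r add0r mul1r.
Qed.

End Slope.

(** * Sign vectors of curves, and strata *)

Section Obstacles.
Variables (R : realType) (k : nat) (o : 'I_k -> R * R).
Hypothesis o_inj : injective o.

Definition height i : R := (o i).1 + (o i).2.

(** [southeast j i] says that curves passing through [o i] or southeast of it
    pass southeast of [o j]. *)
Definition southeast : rel 'I_k := fun j i =>
  [&& j != i, (o j).1 <= (o i).1 & (o i).2 <= (o j).2].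

Definition sign_vector (g : increasing_curve R) : cube_face k :=
  [ffun i => if abscissa g (height i) < (o i).1 then Some false
             else if (o i).1 < abscissa g (height i) then Some true else None].

Lemma southeast_irr : irreflexive southeast.
Proof. by move=> i; rewrite /southeast eqxx. Qed.

Lemma southeast_trans : transitive southeast.
Proof.
move=> j i l /and3P[ij ij1 ij2] /and3P[jl jl1 jl2].
rewrite /southeast (le_trans ij1 jl1) (le_trans jl2 ij2) !andbT.
apply: contra_neq ij => il; subst l; apply: o_inj.
by apply/eqP; rewrite (surjective_pairing (o i)) (surjective_pairing (o j)) xpair_eqE !eq_le
  ij1 jl1 ij2 jl2.
Qed.

(** If [o j] is lower than [o i], use that the second coordinate increases; if it is higher, that
    the first does. At equal heights, strictness comes from the obstacles being distinct. *)
Lemma sign_vector_admissible g : admissible southeast (sign_vector g).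
Proof.
move=> i j /and3P[ji ji1 ji2]; rewrite !ffunE.
case: ltP => // gi _; have su := abscissa_slope g.
suff gj : (o j).1 < abscissa g (height j) by rewrite gj ltNge (ltW gj).
have [ij|ij|ij] := ltgtP (height j) (height i).
- have /andP[_ H] := su _ _ ij; move: gi ij ji1 ji2 H; rewrite /height; lra.
- have /andP[H _] := su _ _ ij; move: gi ij ji1 ji2 H; rewrite /height; lra.
- rewrite ij (lt_le_trans _ gi) // lt_neqAle ji1 andbT.
  apply: contra_neq ji => ji; apply: o_inj.
  rewrite (surjective_pairing (o i)) (surjective_pairing (o j)).
  by move: ij; rewrite /height => ij; congr pair; lra.
Qed.

(** The curve is a maximum of bumps, one for each obstacle not to lie southeast of it. Each bump
    passes through its obstacle or slightly southeast of it, and otherwise stays as far northwest as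
    monotonicity nearly allows. *)
Lemma sign_vector_realizable f : admissible southeast f ->
  exists g, sign_vector g = f.
Proof.
move=> adm.
pose s i j := height i - height j.
(* As [e] tends to 0, the bump of [j] at the height of [i] tends to [(o j).1 + Num.min 0 (s i j)];
   the gap is the room left before [o i]. It equals the maximum of [(o i).1 - (o j).1] and
   [(o j).2 - (o i).2]. *)
pose gap i j := (o i).1 - (o j).1 - Num.min 0 (s i j).
have gap_gt0 i j : i != j -> f i != Some true -> f j != Some false -> 0 < gap i j.
  move=> ij fi fj; have : ~~ southeast i j.
    by apply: contraNN fi => /adm/(_ fj) ->.
  rewrite /southeast ij /= negb_and -!ltNge /gap /s /height => h.
  case: (leP 0 (_ - _)) => h'; case/orP: h => h; lra.
have [e [e0 e1 small]] : exists e : R, [/\ 0 < e, e < 1 / 2 &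
    (* The term 1 accounts for the shift by [e], and the absolute value for the slopes [e] and
       [1 - e] in place of 0 and 1. *)
    forall i j, i != j -> f i != Some true -> f j != Some false ->
      e * (1 + `|s i j|) < gap i j].
  pose P (ij : 'I_k * 'I_k) :=
    [&& ij.1 != ij.2, f ij.1 != Some true & f ij.2 != Some false].
  pose d (ij : 'I_k * 'I_k) := gap ij.1 ij.2 / (1 + `|s ij.1 ij.2|).
  have d0 ij : 0 < 1 + `|s ij.1 ij.2| by rewrite ltr_pwDl.
  pose m := \big[Num.min/1 : R]_(ij | P ij) d ij.
  have m0 : 0 < m.
    apply: lt_bigmin => // ij /and3P[? ? ?]; apply: divr_gt0 => //; exact: gap_gt0.
  have m1 : m <= 1 by exact: bigmin_le_id.
  (* Since [m] is at most 1, dividing by 3 gives both [e < 1 / 2] and the strict bounds. *)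
  exists (m / 3); split; [lra|lra|] => i j ij fi fj.
  have : m <= d (i, j) by apply: bigmin_le_cond; rewrite /P ij fi fj.
  rewrite /d /= ler_pdivlMr; last exact: (d0 (i, j)).
  by have := d0 (i, j); have := gap_gt0 i j ij fi fj => /=; nra.
pose M := \big[Num.max/0 : R]_i (height i / 2 - (o i).1).
(* A line northwest of all obstacles, the default value of the maximum. *)
pose base (t : R) := - (M + 1) + 2^-1 * (t - 0).
pose shift j := (o j).1 + (if f j == Some true then e else 0).
(* As [e < 1 / 2], the minimum has slope [1 - e] before the height of [o j] and slope [e] after
   it. *)
pose bump j t := Num.min (shift j + e * (t - height j))
                       (shift j + (1 - e) * (t - height j)).
have [sb sB] : slope base /\ forall j, slope (bump j).
  split=> [|j]; first by apply: slope_affine; lra.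
  by apply: slope_min; apply: slope_affine; lra.
pose u t := \big[Num.max/base t]_(j | f j != Some false) bump j t.
have su : slope u by exact: slope_bigmax.
have base_lt i : base (height i) < (o i).1.
  have : height i / 2 - (o i).1 <= M by exact: le_bigmax.
  rewrite /base; lra.
have bump_lt i j : i != j -> f i != Some true -> f j != Some false ->
    bump j (height i) < (o i).1.
  move=> ij fi fj; have := small i j ij fi fj; rewrite /bump /gap /shift -/(s i j).
  by case: (leP 0 (s i j)) => h; [rewrite ger0_norm //|rewrite ltr0_norm //];
    rewrite gt_min; case: (f j == _); move=> ?; apply/orP; [left|left|right|right]; nra.
have bump_self i : bump i (height i) = shift i.
  by rewrite /bump subrr !mulr0 addr0 minxx.
exists (curve su); apply/ffunP => i; rewrite ffunE -[abscissa _ _]/(u (height i)).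
have u_ge : f i != Some false -> shift i <= u (height i).
  move=> fi; rewrite -(bump_self i); exact: (le_bigmax_cond _ (fun j => bump j (height i))).
case fi : (f i) u_ge => [[]|] u_ge.
- have := u_ge isT; rewrite /shift fi eqxx => h.
  have {}h : (o i).1 < u (height i) by lra.
  by rewrite h ltNge (ltW h).
- suff -> : u (height i) < (o i).1 by [].
  apply/bigmax_ltP; split=> // j fj; apply: bump_lt => //; last by rewrite fi.
  by apply: contraNneq fj => <-; rewrite fi.
- suff -> : u (height i) = (o i).1 by rewrite ltxx.
  apply/eqP; rewrite eq_le; apply/andP; split; last first.
    by have := u_ge isT; rewrite /shift fi addr0.
  apply/bigmax_leP; split=> [|j fj]; first exact: ltW.
  have [->|ij] := eqVneq j i; first by rewrite bump_self /shift fi addr0.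
  by apply/ltW/bump_lt => //; [rewrite eq_sym|rewrite fi].
Qed.

(** The natural parametrization forces a curve to meet [o i] at time [height i]. *)
Lemma passes_throughP g i : passes_through g (o i) <-> sign_vector g i = None.
Proof.
rewrite ffunE; split=> [[t]|].
  rewrite val_abscissa => gt; have tE : t = height i.
    by rewrite /height -gt /= addrC subrK.
  by rewrite -tE -gt /= ltxx.
case: ltgtP => // gi _; exists (height i).
by rewrite val_abscissa gi /height addrAC subrr add0r -surjective_pairing.
Qed.

Lemma exact_locusE S g :
  exact_locus o S g <-> S = finset (fun i => sign_vector g i == None).
Proof.
split=> [gS|-> i]; last by rewrite passes_throughP inE; split=> [->|/eqP].
by apply/setP => i; rewrite inE; apply/idP/eqP => [/gS/passes_throughP|/passes_throughP/gS].
Qed.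

(** A strict inequality of [h] survives averaging with the same inequality, or an equality, of [g],
    because [h] has positive weight. *)
Lemma sign_vector_segment g h s : 0 < s ->
  subface (sign_vector h) (sign_vector g) ->
  sign_vector (segment_curve g h s) = sign_vector h.
Proof.
move=> s0 hg; apply/ffunP => i; have := hg i; rewrite !ffunE.
rewrite -[abscissa (segment_curve _ _ _) _]/((1 - clamp s) * _ + clamp s * _).
have := clamp_gt0 s0; have := clamp_le1 s.
move: (clamp s) (abscissa g _) (abscissa h _) (o i).1 => c x y z c1 c0.
case: (ltgtP y z) => yz; case: (ltgtP x z) => xz; case=> // _;
  case: (ltgtP ((1 - c) * x + c * y) z) => // E; exfalso; nra.
Qed.

(** Curves with equal signs are joined by a segment inside the locus. Conversely, a connected part
    of the locus cannot change sides of an avoided obstacle, by the intermediate value property. *)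
Lemma sign_vector_component S g : exact_locus o S g ->
  connected_component (exact_locus o S) g = [set h | sign_vector h = sign_vector g].
Proof.
move=> gS; apply/seteqP; split=> h /=; last first.
  move=> hg; have sgE s : sign_vector (segment_curve g h s) = sign_vector g.
    have [s0|s0] := ltP 0 s; first by rewrite sign_vector_segment // hg; exact: subface_refl.
    by rewrite -[in RHS](segment_curve0 g h) /segment_curve /sign_vector;
      apply/ffunP => i; rewrite !ffunE /abscissa /= !clamp_le0.
  apply: (@connected_component_max _ _ (segment_curve g h @` `[0, 1])).
  - by exists 0; rewrite ?segment_curve0 //= in_itv /= lexx ler01.
  - by move=> _ [s _ <-]; apply/exact_locusE; rewrite sgE; apply/exact_locusE.
  - apply: connected_continuous_connected; first exact: segment_connected.
    exact/continuous_subspaceT/segment_curve_continuous.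
  - by exists 1; rewrite ?segment_curve1 //= in_itv /= lexx ler01.
move=> [C [Cg CS Cc] Ch]; apply/ffunP => i.
have [gi|gi] := pselect (sign_vector g i = None).
  rewrite gi; apply/passes_throughP/(CS _ Ch); apply/gS; exact/passes_throughP.
have avoid u : C u -> abscissa u (height i) != (o i).1.
  move=> Cu; apply: contra_notN gi => /eqP ui.
  apply/passes_throughP/gS/(CS _ Cu)/passes_throughP.
  by rewrite ffunE ui ltxx.
have /connected_intervalP itv :
    connected ((fun u : increasing_curve R => abscissa u (height i)) @` C).
  apply: connected_continuous_connected => //.
  exact/continuous_subspaceT/abscissa_continuous.
have gC :
    ((fun u : increasing_curve R => abscissa u (height i)) @` C) (abscissa g (height i)).
  by exists g.
have hC :
    ((fun u : increasing_curve R => abscissa u (height i)) @` C) (abscissa h (height i)).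
  by exists h.
have ghz := itv _ _ gC hC (o i).1; have hgz := itv _ _ hC gC (o i).1.
have := avoid _ Cg; have := avoid _ Ch; rewrite !ffunE.
case: (ltgtP (abscissa h _)) => // hz _; case: (ltgtP (abscissa g _)) => // gz _.
  by have [|u /avoid/eqP] := hgz; rewrite ?(ltW gz) ?(ltW hz).
by have [|u /avoid/eqP] := ghz; rewrite ?(ltW gz) ?(ltW hz).
Qed.

(** Being strictly on one side of an obstacle is an open condition, so [f] keeps the fixed signs of
    [f']. Conversely, the segment from [h] to [g] has sign vector [f] as soon as it leaves [h]. *)
Lemma sign_vector_closure f f' g g' : sign_vector g = f -> sign_vector g' = f' ->
  [set h | sign_vector h = f'] `<=` closure [set h | sign_vector h = f] <->
  subface f f'.
Proof.
move=> gf gf'; split=> [sub i|ff' h /= hf' B hB].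
  have [->|] := pselect (f' i = None); first by left.
  (* This neighbourhood of [g'] consists of the curves strictly on the same side of [o i] as
     [g']. *)
  have := sub _ gf' ((fun u => abscissa u (height i)) @^-1` 
    (if abscissa g' (height i) < (o i).1 then [set x | x < (o i).1]
     else if (o i).1 < abscissa g' (height i) then [set x | (o i).1 < x] else setT)).
  rewrite -gf' ffunE => H; case: ifPn H => [lt_i|ge_i]; last case: ifPn => [gt_i|//];
    move=> H _; right.
  - have [|u [/= <- ui]] := H.
      apply: abscissa_continuous; apply: open_nbhs_nbhs; split=> //; exact: open_lt.
    by rewrite ffunE ui.
  - have [|u [/= <- ui]] := H.
      apply: abscissa_continuous; apply: open_nbhs_nbhs; split=> //; exact: open_gt.
    by rewrite ffunE ui ltNge (ltW ui).
have : nbhs (segment_curve h g 0) B by rewrite segment_curve0.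
move=> /segment_curve_continuous /nbhs_ballP[e /= e0 eB].
exists (segment_curve h g (e / 2)); split.
  by rewrite /= sign_vector_segment ?divr_gt0 // hf' gf.
by apply: eB; rewrite /ball /= sub0r normrN gtr0_norm ?divr_gt0 //; lra.
Qed.

Lemma stratumP (A : stratum o) : exists f, [/\ exists g, sign_vector g = f,
  (\val A).1 = finset (fun i => f i == None) & stratum_set A = [set h | sign_vector h = f]].
Proof.
have /set_mem[g gS AE] := valP A; exists (sign_vector g); split; first by exists g.
  exact/exact_locusE.
by rewrite /stratum_set AE sign_vector_component.
Qed.

(** The choice is unique: a stratum is nonempty and all its curves have this sign vector. *)
Definition stratum_sign (A : stratum o) : cube_face k := projT1 (cid (stratumP A)).

Lemma stratum_signP A : [/\ exists g, sign_vector g = stratum_sign A,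
  (\val A).1 = finset (fun i => stratum_sign A i == None) &
  stratum_set A = [set h | sign_vector h = stratum_sign A]].
Proof. exact: (projT2 (cid (stratumP A))). Qed.

Lemma stratum_sign_inj : injective stratum_sign.
Proof.
move=> A B AB; apply: val_inj.
have [_ A1 A2] := stratum_signP A; have [_ B1 B2] := stratum_signP B.
rewrite [LHS]surjective_pairing [RHS]surjective_pairing; congr pair.
  by rewrite A1 B1 AB.
by rewrite -[LHS]/(stratum_set A) -[RHS]/(stratum_set B) A2 B2 AB.
Qed.

Lemma stratum_sign_surj f : admissible southeast f -> exists A, stratum_sign A = f.
Proof.
move=> /sign_vector_realizable[g gf].
pose S := finset (fun i => f i == None).
have gS : exact_locus o S g by apply/exact_locusE; rewrite gf.
have AP : is_stratum o (S, connected_component (exact_locus o S) g) by exists g.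
exists (SigSub (mem_set AP)); set A := SigSub _.
have [[h hA] _ AE] := stratum_signP A; rewrite -hA -gf.
have : stratum_set A h by rewrite AE.
by rewrite /stratum_set /= sign_vector_component.
Qed.

End Obstacles.

Theorem proposition4p4 (R : realType) (k : nat) (o : 'I_k -> R * R)
  (o_inj : injective o) : cubing R (obstacle_complex o).
Proof.
have sign_adm (A : obstacle_complex o) : admissible (southeast o) (stratum_sign A).
  by have [[g <-] _ _] := stratum_signP A; exact: sign_vector_admissible.
have [cell_of cell_ofK] : exists cell_of : cube_face k -> obstacle_complex o,
    forall f, admissible (southeast o) f -> stratum_sign (cell_of f) = f.
  (* The stratum of the curves northwest of all obstacles serves as the default value of
     [cell_of]. *)
  have [A0 _] : exists A : obstacle_complex o, stratum_sign A = [ffun=> Some false].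
    by apply: stratum_sign_surj => // i j _; rewrite ffunE.
  exists (fun f => if pselect (admissible (southeast o) f) is left fadm
    then projT1 (cid (stratum_sign_surj fadm)) else A0) => f fadm.
  by case: pselect => // ?; case: cid.
apply: (@sign_cubing _ (southeast o) (obstacle_complex o) (@stratum_sign _ _ o) cell_of) => //.
- exact: stratum_sign_inj.
- move=> A; have [_ AE _] := stratum_signP A; rewrite /= /codim AE /cube_face_dim.
  by apply: eq_card => i; rewrite !inE.
- move=> A B; have [[g gA] _ AE] := stratum_signP A; have [[h hB] _ BE] := stratum_signP B.
  by rewrite /= AE BE; exact: (sign_vector_closure gA hB).
- exact: southeast_irr.
- exact: southeast_trans.
Qed.
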